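(* Let $$t(x,y)=\sum_{n=0}^{\infty}\frac{(x)_n\,(x)_{n+1}}{(x+y)_n\,(x+y)_{n+1}}(-1)^n=\frac{x}{x+y}\,{}_{3}F_{2}\!\left[\begin{matrix}x,\,x+1,\,1\\ x+y,\,x+y+1\end{matrix}\,\Bigg|\,-1\right].$$ Then for suitably bounded $x$ and $y$ (such that the series involved converge), $$t(x,y)=\frac{x(2x^2+6xy+5y^2+2x+4y)}{4(x+y)^2(x+y+1)}-\frac{y^2(y+1)(y+2)}{4(x+y)^2(x+y+1)^2}\,t(x,y+2).$$
   Context: $(a)_n=a(a+1)\cdots(a+n-1)$ is the Pochhammer symbol, and ${}_{p}F_{q}\!\left[\begin{matrix}a_1,\dots,a_p\\ b_1,\dots,b_q\end{matrix}\,\Big|\,z\right]=\sum_{k=0}^{\infty}\frac{(a_1)_k\cdots(a_p)_k}{(b_1)_k\cdots(b_q)_k}\frac{z^k}{k!}$. *)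

(* Defs.v *)
From mathcomp Require Export all_boot all_order all_algebra.
From mathcomp Require Export all_classical all_reals all_analysis.
From mathcomp Require Export complex.

Set Implicit Arguments.
Unset Strict Implicit.
Unset Printing Implicit Defensive.

Export Order.TTheory GRing.Theory Num.Theory.
Export numFieldNormedType.Exports.

Local Open Scope classical_set_scope.
Local Open Scope ring_scope.
Local Open Scope complex_scope.

Definition pochhammer (K : pzRingType) (a : K) (n : nat) : K :=
  \prod_(i < n) (a + i%:R).

(* R[i]^o is R[i] equipped with the topology of the modulus; lim of a divergent
   series is a junk value, so convergence has to be assumed separately. *)
Definition pFq_term (R : realType) (a b : seq R[i]) (z : R[i]) : nat -> R[i]^o :=
  fun k => (\prod_(c <- a) pochhammer c k) / (\prod_(c <- b) pochhammer c k)
           * (z ^+ k / k`!%:R).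

Definition pFq (R : realType) (a b : seq R[i]) (z : R[i]) : R[i] :=
  limn (series (pFq_term a b z)).

Definition t_term (R : realType) (x y : R[i]) : nat -> R[i]^o :=
  fun n => pochhammer x n * pochhammer x n.+1
           / (pochhammer (x + y) n * pochhammer (x + y) n.+1) * (-1) ^+ n.

Definition t (R : realType) (x y : R[i]) : R[i] := limn (series (t_term x y)).

(* Main.v *)
Require Import Defs.
From mathcomp Require Import ring.

(** With [u n = t_term x y n], [s = x + y] and [c] the coefficient of
    [t x (y + 2)], the combination [u n + c * t_term x (y + 2) n] telescopes to
    [r n * u n - r n.+1 * u n.+1], where
      r n = 1/2 + y / (2 (s + n)) + y^2 / (4 (s + n) (s + n + 1)).
    Since [r n] tends to [1/2] and the terms of a convergent series tend to [0],
    the sum is [r 0 * u 0], which is the rational term of the recurrence. *)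

Local Open Scope classical_set_scope.
Local Open Scope ring_scope.
Local Open Scope complex_scope.

(** The triangle inequality for [n = (s + n) - s] gives [|s + n| > 1/e] as soon as [n] exceeds
    [1/e + |s|]. *)
Lemma cvg_inv_shift (R : realType) (s : R[i]) :
  (fun n => (s + n%:R)^-1 : R[i]^o) @ \oo --> (0 : R[i]^o).
Proof.
apply/cvgr0Pnorm_lt => e e0.
pose a : R[i] := e^-1 + `|s|.
have aR : a \is Num.real by rewrite realD// gtr0_real// invr_gt0.
(* The order of [R[i]] is only partial; since [a] is real, the Archimedean bound is taken in [R], on
   its real part. *)
have [N aN] : exists N : nat, a < N%:R.
  exists (Num.bound `|complex.Re a|).
  have {1}-> : a = (complex.Re a)%:C by rewrite RRe_real.
  rewrite -(rmorph_nat (real_complex R)) ltcR.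
  exact: le_lt_trans (ler_norm _) (archi_boundP (normr_ge0 _)).
exists N => // n /= Nn.
have h : e^-1 < `|s + n%:R|.
  rewrite -(ltrD2r `|s|) (lt_le_trans aN)//.
  rewrite (@le_trans _ _ n%:R) ?ler_nat//.
  have {1}-> : n%:R = `|(s + n%:R) - s| :> R[i].
    by rewrite [s + _]addrC addrK ger0_norm ?ler0n.
  exact: ler_normB.
rewrite normrV ?unitfE; last first.
  by rewrite -normr_gt0 (lt_trans _ h)// invr_gt0.
rewrite invf_plt// posrE.
by rewrite (lt_trans _ h)// invr_gt0.
Qed.

Lemma pochhammerS (K : pzRingType) (a : K) n :
  pochhammer a n.+1 = pochhammer a n * (a + n%:R).
Proof. by rewrite /pochhammer big_ord_recr. Qed.

Lemma pochhammerSl (K : pzRingType) (a : K) n :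
  pochhammer a n.+1 = a * pochhammer (a + 1) n.
Proof.
rewrite /pochhammer big_ord_recl addr0; congr (_ * _).
by apply: eq_bigr => i _; rewrite /= /bump add1n -natr1 addrAC addrA.
Qed.

Lemma pochhammer1 (K : pzRingType) n : pochhammer (1 : K) n = n`!%:R.
Proof.
elim: n => [|n IHn]; first by rewrite /pochhammer big_ord0.
by rewrite pochhammerS IHn factS mulnC natrM nat1r.
Qed.

Lemma pochhammer_neq0 (K : idomainType) (a : K) n :
  (forall k, a + k%:R != 0) -> pochhammer a n != 0.
Proof. by move=> a0; apply/prodf_neq0 => i _. Qed.

(** Both sides are [pochhammer a n.+2], with two factors split off at the bottom or at the top. *)
Lemma pochhammer_shift2 (K : comPzRingType) (a : K) n :
  a * (a + 1) * pochhammer (a + 2) n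
  = pochhammer a n * (a + n%:R) * (a + n%:R + 1).
Proof.
rewrite -[a + n%:R + 1]addrA natr1 -!pochhammerS !pochhammerSl mulrA.
by rewrite -[a + 1 + 1]addrA -[1 + 1]/2.
Qed.

Section TSeries.
Variables (R : realType) (x y : R[i]).
Hypothesis hxy : forall n : nat, x + y + n%:R != 0.

(** The numerator parameter [1] contributes [n!], which cancels the factorial built into the
    hypergeometric term. *)
Lemma t_term_pFq n :
  t_term x y n
  = x / (x + y) * pFq_term [:: x; x + 1; 1] [:: x + y; x + y + 1] (- 1) n.
Proof.
rewrite /t_term /pFq_term !big_cons !big_nil !mulr1 pochhammer1.
rewrite !pochhammerSl.
have s0 : x + y != 0 by rewrite -[x + y]addr0 (hxy 0).
have p0 := @pochhammer_neq0 _ _ n hxy.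
have p1 : pochhammer (x + y + 1) n != 0.
  by apply: pochhammer_neq0 => k; rewrite -addrA nat1r.
have f0 : n`!%:R != 0 :> R[i] by rewrite pnatr_eq0 -lt0n fact_gt0.
by field; rewrite f0 p1 p0.
Qed.

(** This is [r n], written with inverses so that its limit follows from [cvg_inv_shift]. *)
Definition t_cert n : R[i] :=
  1 / 2 + y / 2 * (x + y + n%:R)^-1
  + y ^+ 2 / 4 * ((x + y + n%:R)^-1 * (x + y + n.+1%:R)^-1).

(** Once every Pochhammer symbol is reduced to those of [x] and [x + y] at [n], a rational identity
    in [x], [y] and [n] remains. *)
Lemma t_term_telescope n :
  t_term x y n + y ^+ 2 * (y + 1) * (y + 2)
      / (4 * (x + y) ^+ 2 * (x + y + 1) ^+ 2) * t_term x (y + 2) n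
  = t_cert n * t_term x y n - t_cert n.+1 * t_term x y n.+1.
Proof.
have s0 : x + y != 0 by rewrite -[x + y]addr0 (hxy 0).
have s1 : x + y + 1 != 0 := hxy 1.
have n0 := hxy n.
have n1 := hxy n.+1.
have n2 := hxy n.+2.
have p0 := @pochhammer_neq0 _ _ n hxy.
have shift k : pochhammer (x + (y + 2)) k =
  pochhammer (x + y) k * (x + y + k%:R) * (x + y + k%:R + 1)
    / ((x + y) * (x + y + 1)).
  by rewrite addrA -pochhammer_shift2 mulrC mulKf// mulf_neq0.
rewrite /t_term /t_cert !shift !pochhammerS (exprS (-1) n).
move: n0 n1 n2; rewrite -!(natr1 n.+1) -!(natr1 n) => n0 n1 n2.
set e := (-1) ^+ n.
field.
by rewrite n0 n1 n2 s0 s1 p0.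
Qed.

Lemma cvg_t_cert :
  t_term x y @ \oo --> (0 : R[i]^o) ->
  (fun n => t_cert n * t_term x y n : R[i]^o) @ \oo --> (0 : R[i]^o).
Proof.
move=> u0; have w0 := @cvg_inv_shift R (x + y).
have w1 : (fun n => (x + y + n.+1%:R)^-1 : R[i]^o) @ \oo --> (0 : R[i]^o).
  by rewrite -cvg_shiftS in w0.
(* The limit [1/2], left in the shape that the sum and product rules produce. *)
pose l : R[i]^o := 1 / 2 + y / 2 * 0 + y ^+ 2 / 4 * (0 * 0).
have r : (t_cert : nat -> R[i]^o) @ \oo --> l.
  apply: cvgD; first apply: cvgD.
  - exact: cvg_cst.
  - exact: cvgMl_tmp w0.
  - exact: cvgMl_tmp (cvgM w0 w1).
have -> : (0 : R[i]^o) = l * 0 by rewrite mulr0.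
exact: cvgM r u0.
Qed.

End TSeries.

Theorem theorem4 (R : realType) (x y : R[i])
    (hxy : forall n : nat, x + y + n%:R != 0)
    (ht : cvgn (series (t_term x y)))
    (ht2 : cvgn (series (t_term x (y + 2)))) :
  t x y = x / (x + y) * pFq [:: x; x + 1; 1] [:: x + y; x + y + 1] (- 1) /\
  t x y =
    x * (2 * x ^+ 2 + 6 * x * y + 5 * y ^+ 2 + 2 * x + 4 * y)
      / (4 * (x + y) ^+ 2 * (x + y + 1))
    - y ^+ 2 * (y + 1) * (y + 2)
      / (4 * (x + y) ^+ 2 * (x + y + 1) ^+ 2) * t x (y + 2).
Proof.
have s0 : x + y != 0 by rewrite -[x + y]addr0 (hxy 0).
have s1 : x + y + 1 != 0 := hxy 1.
split.
  have tE : t_term x y = (x / (x + y)) *: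
      pFq_term [:: x; x + 1; 1] [:: x + y; x + y + 1] (- 1).
    by apply/funext => n; rewrite t_term_pFq.
  (* For x = 0 the hypergeometric series need not converge, but its value is
     multiplied by 0. *)
  have [x0|x0] := eqVneq x 0.
    rewrite /t tE seriesZ x0 !mul0r scale0r.
    by apply: (@cvg_lim _ (@norm_hausdorff _ R[i]^o)); exact: cvg_cst.
  (* For nonzero [x] the prefactor is invertible, so the hypergeometric series inherits its
     convergence from [ht]. *)
  have c0 : x / (x + y) != 0 by rewrite mulf_neq0 ?invr_eq0.
  have pE : pFq_term [:: x; x + 1; 1] [:: x + y; x + y + 1] (- 1) =
      (x / (x + y))^-1 *: t_term x y.
    by rewrite tE scalerA mulVf// scale1r.
  rewrite /pFq pE.
  rewrite (lim_seriesZ _ ht).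
  exact: esym (mulVKf c0 (t x y)).
set c := y ^+ 2 * _ * _ / _.
have l1 : series (t_term x y + c *: t_term x (y + 2)) @ \oo -->
    (t x y + c * t x (y + 2) : R[i]^o).
  by rewrite seriesD seriesZ; apply: cvgD; [exact: ht|exact: cvgZl_tmp ht2].
(* The sign is forced: [telescope G n] is [G n.+1 - G n]. *)
pose G n : R[i]^o := - (t_cert R x y n * t_term x y n).
have GE : t_term x y + c *: t_term x (y + 2) = telescope G.
  apply/funext => n; rewrite /telescope /G /= opprK.
  exact: etrans (t_term_telescope R x y hxy n) (addrC _ _).
have l2 : series (telescope G) @ \oo --> (- 0 - G 0 : R[i]^o).
  rewrite telescopeK; apply: cvgB; last exact: cvg_cst.
  by apply: cvgN; apply: cvg_t_cert; exact: cvg_series_cvg_0 ht.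
rewrite -GE in l2.
(* [l1] and [l2] are limits of the same series, so they agree; what remains is to evaluate [- G 0],
   with [t_term x y 0 = x / (x + y)]. *)
apply: (addIr (c * t x (y + 2))); rewrite subrK.
apply: etrans (cvg_unique (@norm_hausdorff _ R[i]^o) l1 l2) _.
rewrite oppr0 sub0r opprK /t_cert /t_term /pochhammer !big_ord_recl !big_ord0.
rewrite !addr0 expr0 !mulr1 !mul1r.
field.
by rewrite s1 s0.
Qed.
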